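(* Let $\alpha>0$, let $N\geq 3$ be an integer, let $I\subset\mathbb{R}$ be an interval, and for $k=1,\dots,N$ let $p_k,q_k$ be continuous real-valued functions on $I$. Let $u_1,\dots,u_N$ be real-valued functions on $I$ such that, for each $k$, $u_k$ and $p_k\varphi(u_k')$ are differentiable on $I$, $u_k$ does not vanish in $I$, and $$(p_k(x)\varphi(u_k'))'+q_k(x)\varphi(u_k)=0\quad\text{on } I .$$ Then the following identity holds on $I$: $$ \begin{aligned} &\frac{d}{dx}\Big\{u_{N-1}\varphi(u_{N-1})\Big[\sum_{k=0}^{N-1}(-1)^{N-k-1}\binom{N-1}{k}p_{k+1}(x)\frac{\varphi(u_{k+1}')}{\varphi(u_{k+1})}\Big]\Big\}\\ &=\Big[\sum_{k=0}^{N-1}(-1)^{N-k-1}\binom{N-1}{k}p_{k+1}(x)\Big]u_{N-1}'\varphi(u_{N-1}')-\Big[\sum_{k=0}^{N-1}(-1)^{N-k-1}\binom{N-1}{k}q_{k+1}(x)\Big]u_{N-1}\varphi(u_{N-1})\\ &\quad-\sum_{k=0}^{N-1}(-1)^{N-k-1}\binom{N-1}{k}p_{k+1}(x)\Big[|u_{N-1}'|^{\alpha+1}+\alpha\Big|u_{k+1}'\frac{u_{N-1}}{u_{k+1}}\Big|^{\alpha+1}-(\alpha+1)u_{N-1}'\varphi\Big(u_{N-1}\frac{u_{k+1}'}{u_{k+1}}\Big)\Big]. \end{aligned} $$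
   Context: For $\alpha>0$, $\varphi(s)=|s|^{\alpha-1}s$ for $s\in\mathbb{R}$, with $\varphi(0)=0$. A prime denotes $d/dx$. *)

(* Defs.v *)
From Stdlib Require Import Reals.
Open Scope R_scope.

(* Real power of a nonnegative base with 0^a = 0.  [Rpower] alone cannot be
   used at base 0: [ln 0 = 0] in the library, hence [Rpower 0 a = 1]. *)
Definition rpow (x a : R) : R :=
  if Req_EM_T x 0 then 0 else Rpower x a.

(* [phi alpha 0 = 0] for every [alpha], also when [alpha < 1]. *)
Definition phi (alpha s : R) : R := rpow (Rabs s) (alpha - 1) * s.

(* Intervals of any kind: open, closed, half-open, bounded or not. *)
Definition is_interval (I : R -> Prop) : Prop :=
  forall x y z : R, I x -> I y -> x <= z <= y -> I z.

(* Functions on I are total functions of which only the values on I matter: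
   [continue_in] and [D_in] take limits within I, hence one-sided ones at an
   endpoint belonging to I.  The derivative is unique when I is not a single
   point; on a one-point I [D_in] holds of everything. *)
Definition continuous_on (I : R -> Prop) (f : R -> R) : Prop :=
  forall x : R, I x -> continue_in f I x.

Definition has_derivative_on (I : R -> Prop) (f df : R -> R) : Prop :=
  forall x : R, I x -> D_in f df I x.

Definition coef (N k : nat) : R := (-1) ^ (N - k - 1) * C (N - 1) k.

(* Main.v *)
Require Import Defs.
From Stdlib Require Import Reals Lra Lia.
Open Scope R_scope.

(** The identity is the linear combination, with coefficients [coef N k], of one
    identity for each [u = u_(k+1)], paired with the fixed [v = u_(N-1)].  With
    [w = p phi(u')] and [w' + q phi(u) = 0], each of these is Picone's identity
    for half-linear equations (lemma [picone_identity]),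
    [(v phi(v) w / phi(u))' = p v' phi(v') - q v phi(v) - p E(v', v u' / u)],
    where [E(a, b) = |a|^(alpha+1) + alpha |b|^(alpha+1)
    - (alpha+1) a phi(b)].

    Since [phi'(s) = alpha phi(s) / s] for [s <> 0], the product and quotient
    rules write the left-hand side as
    [(alpha+1) v' phi(v) w / phi(u) - q v phi(v)
    - alpha v phi(v) w u' / (u phi(u))].
    As [phi] is multiplicative, [phi(v) phi(u') / phi(u)] is
    [phi(v u' / u)]; and [|s|^(alpha+1) = s phi(s)] shows that the terms
    [p v' phi(v')] and [p |v'|^(alpha+1)] on the right cancel, and that what is
    left agrees with the left-hand side. *)

(** * The function phi *)

Lemma phi_mult (alpha a b : R) :
  phi alpha (a * b) = phi alpha a * phi alpha b.
Proof.
  unfold phi.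
  destruct (Req_dec a 0) as [-> | ha]; [ring_simplify; reflexivity |].
  destruct (Req_dec b 0) as [-> | hb]; [ring_simplify; reflexivity |].
  pose proof (Rabs_pos_lt a ha) as pa. pose proof (Rabs_pos_lt b hb) as pb.
  rewrite Rabs_mult. unfold rpow.
  destruct (Req_EM_T (Rabs a * Rabs b) 0); [nra |].
  destruct (Req_EM_T (Rabs a) 0); [lra |].
  destruct (Req_EM_T (Rabs b) 0); [lra |].
  rewrite <- Rpower_mult_distr by assumption. ring.
Qed.

Lemma phi_neq_0 (alpha s : R) : s <> 0 -> phi alpha s <> 0.
Proof.
  intros hs. pose proof (Rabs_pos_lt s hs) as ps. unfold phi, rpow.
  destruct (Req_EM_T (Rabs s) 0); [lra |].
  apply Rmult_integral_contrapositive_currified; [| exact hs].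
  apply Rgt_not_eq, exp_pos.
Qed.

Lemma phi_div (alpha a b : R) :
  b <> 0 -> phi alpha (a / b) = phi alpha a / phi alpha b.
Proof.
  intros hb. pose proof (phi_neq_0 alpha b hb) as hphi.
  replace (phi alpha a) with (phi alpha (a / b) * phi alpha b).
  - field. exact hphi.
  - rewrite <- phi_mult. f_equal. field. exact hb.
Qed.

Lemma rpow_Rabs_succ (alpha s : R) :
  rpow (Rabs s) (alpha + 1) = s * phi alpha s.
Proof.
  unfold phi, rpow. destruct (Req_EM_T (Rabs s) 0) as [e | ne]; [ring |].
  assert (ps : 0 < Rabs s) by (pose proof (Rabs_pos s); lra).
  replace (alpha + 1) with (alpha - 1 + 1 + 1) by ring.
  rewrite !Rpower_plus, Rpower_1 by exact ps.
  assert (hsq : Rabs s * Rabs s = s * s)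
    by (rewrite <- Rabs_mult; apply Rabs_pos_eq; nra).
  rewrite Rmult_assoc, hsq. ring.
Qed.

Lemma phi_pos_eq (alpha s : R) : 0 < s -> phi alpha s = Rpower s alpha.
Proof.
  intros hs. unfold phi, rpow. rewrite Rabs_pos_eq by lra.
  destruct (Req_EM_T s 0); [lra |].
  rewrite <- (Rpower_1 s hs) at 2. rewrite <- Rpower_plus. f_equal. ring.
Qed.

Lemma phi_opp (alpha s : R) : phi alpha (- s) = - phi alpha s.
Proof. unfold phi. rewrite Rabs_Ropp. ring. Qed.

Lemma derivable_pt_lim_phi_pos (alpha s : R) :
  0 < s -> derivable_pt_lim (phi alpha) s (alpha * (phi alpha s / s)).
Proof.
  intros hs.
  apply derivable_pt_lim_locally_ext
    with (f := fun y => Rpower y alpha) (a := 0) (b := s + 1); [lra | |].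
  - intros z hz. symmetry. apply phi_pos_eq. lra.
  - replace (phi alpha s / s) with (Rpower s (alpha - 1)).
    + apply derivable_pt_lim_power. exact hs.
    + unfold phi, rpow. rewrite Rabs_pos_eq by lra.
      destruct (Req_EM_T s 0); [lra |]. field. lra.
Qed.

(** The derivative is stated as [alpha phi(s) / s] rather than
    [alpha |s|^(alpha-1)], so that powers no longer occur afterwards.  The
    negative half-line follows from the positive one because [phi] is odd. *)
Lemma derivable_pt_lim_phi (alpha s : R) :
  s <> 0 -> derivable_pt_lim (phi alpha) s (alpha * (phi alpha s / s)).
Proof.
  intros hs. destruct (Rlt_dec 0 s) as [pos | npos].
  - apply derivable_pt_lim_phi_pos. exact pos.
  - assert (pos : 0 < - s) by lra.
    apply derivable_pt_lim_locally_ext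
      with (f := (- comp (phi alpha) (- id))%F) (a := s - 1) (b := 0); [lra | |].
    + intros z _. unfold opp_fct, comp, id. rewrite phi_opp. ring.
    + replace (alpha * (phi alpha s / s))
        with (- (alpha * (phi alpha (- s) / - s) * - 1))
        by (rewrite phi_opp; field; exact hs).
      apply derivable_pt_lim_opp, derivable_pt_lim_comp.
      * apply derivable_pt_lim_opp, derivable_pt_lim_id.
      * apply derivable_pt_lim_phi_pos. exact pos.
Qed.

Lemma derivable_pt_lim_Rinv (s : R) :
  s <> 0 -> derivable_pt_lim Rinv s (- / Rsqr s).
Proof.
  intros hs. apply derivable_pt_lim_ext with (f := (fct_cte 1 / id)%F).
  - intros z. unfold div_fct, fct_cte, id, Rdiv. ring.
  - replace (- / Rsqr s) with ((0 * id s - 1 * fct_cte 1 s) / Rsqr (id s))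
      by (unfold fct_cte, id, Rsqr; field; exact hs).
    apply derivable_pt_lim_div; [| | exact hs].
    + apply derivable_pt_lim_const.
    + apply derivable_pt_lim_id.
Qed.

(** * Derivatives relative to a subset *)

Lemma D_in_ext_on (D : R -> Prop) (f g df : R -> R) (x : R) :
  D x -> (forall y, D y -> f y = g y) -> D_in f df D x -> D_in g df D x.
Proof.
  intros hx hfg. unfold D_in. apply limit1_ext.
  intros y [hy _]. rewrite (hfg y hy), (hfg x hx). reflexivity.
Qed.

(** [D_in] uses its derivative only through the value at the point, so a
    constant function can carry a pointwise derivative. *)
Lemma D_in_value (D : R -> Prop) (f df : R -> R) (x l : R) :
  df x = l -> D_in f df D x -> D_in f (fun _ => l) D x.
Proof. intros <- h. exact h. Qed.

Lemma D_in_comp_derivable (D : R -> Prop) (f g df : R -> R) (x l : R) :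
  D_in f df D x -> derivable_pt_lim g (f x) l ->
  D_in (fun y => g (f y)) (fun _ => df x * l) D x.
Proof.
  intros hf hg.
  assert (hg' : D_in g (fun _ => l) no_cond (f x))
    by (apply derivable_pt_lim_D_in; exact hg).
  pose proof (Dcomp _ _ _ _ _ _ _ hf hg') as h.
  unfold D_in in *. eapply limit1_imp; [| exact h].
  intros y [hy hne]. repeat split; assumption.
Qed.

Lemma D_in_linear_combination (D : R -> Prop) (x : R) (c : nat -> R)
  (f : nat -> R -> R) (d : nat -> R) (n : nat) :
  (forall k, (k <= n)%nat -> D_in (f k) (fun _ => d k) D x) ->
  D_in (fun y => sum_f_R0 (fun k => c k * f k y) n)
       (fun _ => sum_f_R0 (fun k => c k * d k) n) D x.
Proof.
  induction n as [| n IH]; intros h; simpl.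
  - apply (Dmult_const D (f 0%nat) (fun _ => d 0%nat)). apply h. lia.
  - apply (Dadd D (fun _ => sum_f_R0 (fun k => c k * d k) n)
             (fun _ => c (S n) * d (S n))
             (fun y => sum_f_R0 (fun k => c k * f k y) n)
             (fun y => c (S n) * f (S n) y)).
    + apply IH. intros k hk. apply h. lia.
    + apply (Dmult_const D (f (S n)) (fun _ => d (S n))). apply h. lia.
Qed.

(** * Picone's identity *)

(** The equation gives [dw] in terms of [u]; after the product and chain rules,
    rewriting every power as a multiple of a value of [phi] and splitting [phi]
    over products and quotients leaves an identity of rational functions in
    [du], [dv], [u x], [v x] and their images under [phi]. *)
Lemma picone_identity (alpha : R) (D : R -> Prop) (x : R)
  (u v p w : R -> R) (du dv dw q : R) :
  u x <> 0 -> v x <> 0 ->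
  D_in u (fun _ => du) D x -> D_in v (fun _ => dv) D x ->
  D_in w (fun _ => dw) D x ->
  w x = p x * phi alpha du -> dw + q * phi alpha (u x) = 0 ->
  D_in (fun y => v y * phi alpha (v y) * (w y / phi alpha (u y)))
    (fun _ => p x * (dv * phi alpha dv) - q * (v x * phi alpha (v x))
       - p x * (rpow (Rabs dv) (alpha + 1)
                + alpha * rpow (Rabs (du * (v x / u x))) (alpha + 1)
                - (alpha + 1) * dv * phi alpha (v x * (du / u x)))) D x.
Proof.
  intros hu hv Du Dv Dw hw hdw.
  pose proof (phi_neq_0 alpha (u x) hu) as hphi.
  pose proof (D_in_comp_derivable _ _ _ _ _ _ Dv
                (derivable_pt_lim_phi alpha (v x) hv)) as Dphiv.
  pose proof (D_in_comp_derivable _ _ _ _ _ _ Du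
                (derivable_pt_lim_phi alpha (u x) hu)) as Dphiu.
  pose proof (D_in_comp_derivable _ _ _ _ _ _ Dphiu
                (derivable_pt_lim_Rinv _ hphi))
    as Dinv.
  pose proof (Dmult _ _ _ _ _ _ (Dmult _ _ _ _ _ _ Dv Dphiv)
                (Dmult _ _ _ _ _ _ Dw Dinv)) as H.
  refine (D_in_value _ _ _ _ _ _ H).
  simpl. replace dw with (- q * phi alpha (u x)) by lra.
  rewrite hw, !rpow_Rabs_succ, !phi_mult, !phi_div by assumption.
  unfold Rsqr. field. repeat split; assumption.
Qed.

Theorem mainTheorem3
  (alpha : R) (halpha : 0 < alpha)
  (N : nat) (hN : (3 <= N)%nat)
  (I : R -> Prop) (hI : is_interval I)
  (p q : nat -> R -> R)
  (hp : forall k : nat, (1 <= k <= N)%nat -> continuous_on I (p k))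
  (hq : forall k : nat, (1 <= k <= N)%nat -> continuous_on I (q k))
  (u u' w' : nat -> R -> R)
  (hu : forall k : nat, (1 <= k <= N)%nat -> has_derivative_on I (u k) (u' k))
  (hw : forall k : nat, (1 <= k <= N)%nat ->
     has_derivative_on I (fun x => p k x * phi alpha (u' k x)) (w' k))
  (hu0 : forall k : nat, (1 <= k <= N)%nat -> forall x : R, I x -> u k x <> 0)
  (heq : forall k : nat, (1 <= k <= N)%nat -> forall x : R, I x ->
     w' k x + q k x * phi alpha (u k x) = 0) :
  has_derivative_on I
    (fun x =>
       u (N - 1)%nat x * phi alpha (u (N - 1)%nat x) *
       sum_f_R0 (fun k => coef N k * p (k + 1)%nat x *
          (phi alpha (u' (k + 1)%nat x) / phi alpha (u (k + 1)%nat x))) (N - 1))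
    (fun x =>
       sum_f_R0 (fun k => coef N k * p (k + 1)%nat x) (N - 1) *
         (u' (N - 1)%nat x * phi alpha (u' (N - 1)%nat x))
       - sum_f_R0 (fun k => coef N k * q (k + 1)%nat x) (N - 1) *
         (u (N - 1)%nat x * phi alpha (u (N - 1)%nat x))
       - sum_f_R0 (fun k => coef N k * p (k + 1)%nat x *
           (rpow (Rabs (u' (N - 1)%nat x)) (alpha + 1)
            + alpha * rpow (Rabs (u' (k + 1)%nat x *
                        (u (N - 1)%nat x / u (k + 1)%nat x))) (alpha + 1)
            - (alpha + 1) * u' (N - 1)%nat x *
              phi alpha (u (N - 1)%nat x *
                        (u' (k + 1)%nat x / u (k + 1)%nat x)))) (N - 1)).
Proof.
  intros x hx.
  (* Moving the common factor inside the sum reduces the claim to its terms. *)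
  apply D_in_ext_on with (f := fun y =>
    sum_f_R0 (fun k => coef N k *
      (u (N - 1)%nat y * phi alpha (u (N - 1)%nat y) *
       (p (k + 1)%nat y * phi alpha (u' (k + 1)%nat y)
        / phi alpha (u (k + 1)%nat y)))) (N - 1)).
  - exact hx.
  - intros y _. rewrite scal_sum. apply sum_eq. intros k _.
    unfold Rdiv. ring.
  - eapply D_in_value.
    2: { apply D_in_linear_combination. intros k hk.
         apply (picone_identity alpha I x (u (k + 1)%nat) (u (N - 1)%nat)
           (p (k + 1)%nat)
           (fun y => p (k + 1)%nat y * phi alpha (u' (k + 1)%nat y))
           (u' (k + 1)%nat x) (u' (N - 1)%nat x) (w' (k + 1)%nat x)
           (q (k + 1)%nat x)).
         - apply hu0; [lia | exact hx].
         - apply hu0; [lia | exact hx].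
         - apply hu; [lia | exact hx].
         - apply hu; [lia | exact hx].
         - apply hw; [lia | exact hx].
         - reflexivity.
         - apply heq; [lia | exact hx]. }
    cbv beta. rewrite !(Rmult_comm (sum_f_R0 _ _)), !scal_sum, <- !minus_sum.
    apply sum_eq. intros k _. ring.
Qed.
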